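(* Let $\kappa\in\mathbb{R}$. If the Markov generator $L$ satisfies $CD_\Upsilon(\kappa,\infty)$, then $L$ also satisfies the Bakry–Émery condition $CD(\kappa,\infty)$.
   Context: Setting. $X$ is a finite or countably infinite set and $k:X\times X\to\mathbb{R}$ are transition rates: $k(x,y)\ge 0$ for $x\neq y$ and $k(x,x)=-\sum_{y\neq x}k(x,y)<0$. The generator is $Lf(x)=\sum_{y\in X}k(x,y)(f(y)-f(x))$. Standing assumptions: the chain is irreducible (for all $x,y\in X$ there are $x=z_1,\dots,z_m=y$, $m\ge2$, with $k(z_i,z_{i+1})>0$); it has an invariant measure $\mu$, unique up to positive multiples, with density $\pi:X\to(0,\infty)$ with respect to counting measure; detailed balance $\pi(x)k(x,y)=\pi(y)k(y,x)$ holds; and for every $x\in X$, $\sum_{y\neq x}k(x,y)<\infty$ and $\sum_{y\neq x}k(x,y)\sum_{z\neq y}k(y,z)<\infty$. Curvature conditions. $\ell^\infty(X)$ denotes the bounded real functions on $X$. $\Gamma(f,g)=\frac12(L(fg)-fLg-gLf)$, i.e. $\Gamma(f,g)(x)=\frac12\sum_yk(x,y)(f(y)-f(x))(g(y)-g(x))$; $\Gamma(f)=\Gamma(f,f)$; $\Gamma_2(f)=\frac12(L\Gamma(f)-2\Gamma(f,Lf))$. $L$ satisfies $CD(\kappa,\infty)$ if $\Gamma_2(f)\ge\kappa\Gamma(f)$ on $X$ for all $f\in\ell^\infty(X)$. With $\Upsilon(r)=e^r-1-r$, set $\Psi_\Upsilon(f)(x)=\sum_{y}k(x,y)\Upsilon(f(y)-f(x))$,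 $B_{\Upsilon'}(f,g)(x)=\sum_y k(x,y)\Upsilon'(f(y)-f(x))(g(y)-g(x))$, $\Psi_{2,\Upsilon}(f)=\frac12\big(L\Psi_\Upsilon(f)-B_{\Upsilon'}(f,Lf)\big)$. $L$ satisfies $CD_\Upsilon(\kappa,\infty)$ if $\Psi_{2,\Upsilon}(f)\ge\kappa\Psi_\Upsilon(f)$ on $X$ for all $f\in\ell^\infty(X)$. *)

(* Defs.v *)
From HB Require Import structures.
From mathcomp Require Import all_boot all_order all_algebra.
From mathcomp Require Import boolp classical_sets functions cardinality fsbigop.
From mathcomp Require Import reals ereal topology normedtype sequences numfun.
From mathcomp Require Import esum derive exp.

Set Implicit Arguments.
Unset Strict Implicit.
Unset Printing Implicit Defensive.

Import Order.TTheory GRing.Theory Num.Theory numFieldNormedType.Exports.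

Local Open Scope classical_set_scope.
Local Open Scope ring_scope.

Section MarkovGenerator.
Context {R : realType} {X : countType}.

(* [\esum] is only meaningful for nonnegative terms, so a real series indexed
   by X is summed as (positive part) - (negative part).  This is the usual sum
   whenever the series converges absolutely, as every series below does under
   [markov_assumptions] for bounded [f]. *)
Definition csum (a : X -> R) : R :=
  fine (\esum_(y in [set: X]) ((EFin \o a)^\+ y)
        - \esum_(y in [set: X]) ((EFin \o a)^\- y))%E.

Variable k : X -> X -> R.

(* Total rate of leaving x, possibly infinite a priori. *)
Definition exit_rate (x : X) : \bar R :=
  \esum_(y in [set~ x]) (k x y)%:E.

(* The balance equation sum_x p(x) k(x,y) = 0, with the (negative) diagonal
   term moved to the right so that all summands are nonnegative. *)
Definition is_invariant (p : X -> R) : Prop :=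
  forall y, \esum_(x in [set~ y]) (p x * k x y)%:E = (- (p y * k y y))%:E.

Record markov_assumptions (p : X -> R) : Prop := MarkovAssumptions {
  rate_ge0 : forall x y, x != y -> 0 <= k x y ;
  rate_diag : forall x, (k x x)%:E = (- exit_rate x)%E ;
  rate_diag_lt0 : forall x, k x x < 0 ;
  (* Paths z_1, ..., z_m with m >= 2: [x] followed by a nonempty sequence. *)
  irreducible_chain : forall x y, exists s : seq X,
    [/\ s != [::], path (fun u v => 0 < k u v) x s & last x s = y] ;
  dens_gt0 : forall x, 0 < p x ;
  dens_invariant : is_invariant p ;
  dens_unique : forall q : X -> R,
    (forall x, 0 <= q x) -> (exists x, q x != 0) -> is_invariant q ->
    exists2 c : R, 0 < c & forall x, q x = c * p x ;
  detailed_balance : forall x y, p x * k x y = p y * k y x ;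
  exit_rate_fin : forall x, (exit_rate x < +oo)%E ;
  exit_rate2_fin : forall x,
    (\esum_(y in [set~ x]) ((k x y)%:E * exit_rate y) < +oo)%E }.

Definition generator (f : X -> R) (x : X) : R :=
  csum (fun y => k x y * (f y - f x)).

Local Notation L := generator.

Definition Gamma (f g : X -> R) (x : X) : R :=
  2^-1 * (L (f \* g) x - f x * L g x - g x * L f x).

Definition Gamma2 (f : X -> R) (x : X) : R :=
  2^-1 * (L (Gamma f f) x - 2 * Gamma f (L f) x).

Definition CD (kappa : R) : Prop :=
  forall f : X -> R, bounded_fun f ->
  forall x, kappa * Gamma f f x <= Gamma2 f x.

Definition Upsilon (r : R) : R := expR r - 1 - r.

Definition Psi_Upsilon (f : X -> R) (x : X) : R :=
  csum (fun y => k x y * Upsilon (f y - f x)).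

Definition B_Upsilon' (f g : X -> R) (x : X) : R :=
  csum (fun y => k x y * derive1 Upsilon (f y - f x) * (g y - g x)).

Definition Psi2_Upsilon (f : X -> R) (x : X) : R :=
  2^-1 * (L (Psi_Upsilon f) x - B_Upsilon' f (L f) x).

Definition CD_Upsilon (kappa : R) : Prop :=
  forall f : X -> R, bounded_fun f ->
  forall x, kappa * Psi_Upsilon f x <= Psi2_Upsilon f x.

End MarkovGenerator.

(* Main.v *)
(* Apply CD_Upsilon to e f and let e tend to 0.  As Upsilon r = r^2/2 + O(r^3)
   and Upsilon' r = r + O(r^2), one has Psi_Upsilon (e f) = e^2 Gamma f + O(e^3)
   and Psi2_Upsilon (e f) = e^2 Gamma2 f + O(e^3).  The first error, at y, is
   O(e^3) times the exit rate of y, which the outer generator may be applied to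
   because sum_y k(x,y) (exit rate of y) is finite. *)

Require Import Defs.
From HB Require Import structures.
From mathcomp Require Import all_boot all_order all_algebra.
From mathcomp Require Import boolp classical_sets functions fsbigop.
From mathcomp Require Import reals ereal topology normedtype sequences numfun.
From mathcomp Require Import esum derive exp.
From mathcomp Require Import ring lra.

Set Implicit Arguments.
Unset Strict Implicit.
Unset Printing Implicit Defensive.

Import Order.TTheory GRing.Theory Num.Theory numFieldNormedType.Exports.

Local Open Scope classical_set_scope.
Local Open Scope ring_scope.

(** * Linearity and domination for absolutely convergent countable sums *)

Section CountableSums.
Context {R : realType} {X : countType}.
Implicit Types (a b u v : X -> R) (c : R).

Definition csummable a := summable [set: X] (EFin \o a).

Lemma esumZl (T : choiceType) (S : set T) c (g : T -> \bar R) :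
  0 <= c -> (forall i, 0 <= g i)%E ->
  \esum_(i in S) (c%:E * g i)%E = (c%:E * \esum_(i in S) g i)%E.
Proof.
move=> c0 g0; rewrite /esum -ereal_supZl//; last first.
  (* The empty sum shows that the set of finite partial sums is nonempty, as scaling a supremum
     requires. *)
  apply/set0P; exists (\sum_(i \in set0) g i)%E => /=.
  by exists set0 => //; split.
congr ereal_sup; apply/seteqP; split => [_ [A AS <-]|_ [_ [A AS <-] <-]] /=.
  by exists (\sum_(i \in A) g i)%E; [exists A|rewrite ge0_mule_fsumr].
by exists A => //; rewrite ge0_mule_fsumr.
Qed.

Lemma esum_fin_num u : csummable u -> (forall y, 0 <= u y) ->
  (\esum_(y in [set: X]) (u y)%:E)%E \is a fin_num.
Proof.
move=> + u0; rewrite /csummable summableE; congr (_ \is a fin_num).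
by apply: eq_esum => y _ /=; rewrite ger0_norm.
Qed.

(** [csum] uses the positive and negative parts of [u - v], which differ from [u] and [v] where
    these overlap; [esumB] cancels the overlap. *)
Lemma csum_subE u v : csummable u -> csummable v ->
  (forall y, 0 <= u y) -> (forall y, 0 <= v y) ->
  csum (fun y => u y - v y) =
  fine (\esum_(y in [set: X]) (u y)%:E) - fine (\esum_(y in [set: X]) (v y)%:E).
Proof.
move=> su sv u0 v0; rewrite /csum.
have := esumB su sv; rewrite /= => ->; last 2 first.
- by move=> y _; rewrite lee_fin.
- by move=> y _; rewrite lee_fin.
by rewrite fineB//; exact: esum_fin_num.
Qed.

Lemma ge0_csumE u : csummable u -> (forall y, 0 <= u y) ->
  csum u = fine (\esum_(y in [set: X]) (u y)%:E).
Proof.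
move=> su u0; have s0 : csummable (fun=> 0).
  by rewrite /csummable /summable esum1// => y _ /=; rewrite normr0.
have := csum_subE su s0 u0 (fun=> lexx 0).
rewrite [X in _ - fine X]esum1// subr0 => <-.
by congr csum; apply/funext => y; rewrite subr0.
Qed.

Lemma csummable_le a b : csummable b -> (forall y, `|a y| <= b y) -> csummable a.
Proof.
rewrite /csummable /summable => sb ab; apply: le_lt_trans sb.
by apply: le_esum => y _ /=; rewrite lee_fin (le_trans (ab y))// ler_norm.
Qed.

Lemma csummableD a b : csummable a -> csummable b ->
  csummable (fun y => a y + b y).
Proof. exact: summableD. Qed.

Lemma csummableZ c a : csummable a -> csummable (fun y => c * a y).
Proof.
rewrite /csummable /summable => sa.
rewrite (@eq_esum _ _ _ _ (fun y => (`|c|%:E * `|(a y)%:E|)%E)); last first.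
  by move=> y _ /=; rewrite normrM.
by rewrite esumZl// ?lte_mul_pinfty// ?lee_fin// ?esum_ge0.
Qed.

Lemma csummable_norm a : csummable a -> csummable (fun y => `|a y|).
Proof.
rewrite /csummable /summable => sa; apply: le_lt_trans sa.
by apply: le_esum => y _ /=; rewrite normr_id.
Qed.

(** Reduces linearity of [csum] to nonnegative summands, where [esum] is additive. *)
Lemma csum_posneg a : csummable a ->
  exists u v, [/\ csummable u, csummable v, forall y, 0 <= u y,
    forall y, 0 <= v y & a = (fun y => u y - v y)].
Proof.
move=> /csummable_norm sa.
exists (fun y => Num.max (a y) 0), (fun y => Num.max (- a y) 0); split.
- by apply: csummable_le sa _ => y; case: (leP 0 (a y)) => ?;
    rewrite ?normr0// ger0_norm.
- by apply: csummable_le sa _ => y; case: (leP (- a y) 0) => ?;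
    rewrite ?normr0// normrN.
- by move=> y; rewrite le_max lexx orbT.
- by move=> y; rewrite le_max lexx orbT.
- by apply/funext => y; case: (leP (a y) 0); case: (leP (- a y) 0) => *; lra.
Qed.

Lemma ge0_csumD u v : csummable u -> csummable v ->
  (forall y, 0 <= u y) -> (forall y, 0 <= v y) ->
  csum (fun y => u y + v y) = csum u + csum v.
Proof.
move=> su sv u0 v0; have suv := csummableD su sv.
rewrite !ge0_csumE//; last by move=> y; rewrite addr_ge0.
by rewrite -fineD ?esum_fin_num// -esumD// => y _; rewrite lee_fin.
Qed.

Lemma csum_sub_ge0 u v : csummable u -> csummable v ->
  (forall y, 0 <= u y) -> (forall y, 0 <= v y) ->
  csum (fun y => u y - v y) = csum u - csum v.
Proof. by move=> *; rewrite csum_subE// !ge0_csumE. Qed.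

Lemma csumD a b : csummable a -> csummable b ->
  csum (fun y => a y + b y) = csum a + csum b.
Proof.
move=> /csum_posneg[u [v [su sv u0 v0 ->]]] /csum_posneg[u' [v' [su' sv' u0' v0' ->]]].
transitivity (csum (fun y => (u y + u' y) - (v y + v' y))).
  by congr csum; apply/funext => y; lra.
rewrite !csum_sub_ge0 ?ge0_csumD//; [lra|exact: csummableD..| |];
  by move=> y; rewrite addr_ge0.
Qed.

Lemma ge0_csumZ c u : csummable u -> 0 <= c -> (forall y, 0 <= u y) ->
  csum (fun y => c * u y) = c * csum u.
Proof.
move=> su c0 u0; rewrite !ge0_csumE//.
- rewrite (@eq_esum _ _ _ _ (fun y => c%:E * (u y)%:E)%E)// esumZl//.
    by rewrite fineM// esum_fin_num.
- exact: csummableZ.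
- by move=> y; rewrite mulr_ge0.
Qed.

Lemma csumZ c a : csummable a -> csum (fun y => c * a y) = c * csum a.
Proof.
move=> /csum_posneg[u [v [su sv u0 v0 ->]]].
have [c0|/ltW c0] := leP 0 c.
  transitivity (csum (fun y => c * u y - c * v y)).
    by congr csum; apply/funext => y; lra.
  rewrite !csum_sub_ge0 ?ge0_csumZ//; [lra|exact: csummableZ..| |];
    by move=> y; rewrite mulr_ge0.
(* For negative [c] the two parts trade roles, which makes the coefficient [- c] nonnegative. *)
transitivity (csum (fun y => (- c) * v y - (- c) * u y)).
  by congr csum; apply/funext => y; lra.
rewrite !csum_sub_ge0 ?ge0_csumZ ?oppr_ge0//; [lra|exact: csummableZ..| |];
  by move=> y; rewrite mulr_ge0// oppr_ge0.
Qed.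

Lemma csum_ge0 u : (forall y, 0 <= u y) -> csummable u -> 0 <= csum u.
Proof.
move=> u0 su; rewrite ge0_csumE//; apply: fine_ge0; apply: esum_ge0 => y _.
by rewrite lee_fin.
Qed.

Lemma csummableB a b : csummable a -> csummable b ->
  csummable (fun y => a y - b y).
Proof. exact: summableB. Qed.

Lemma csumB a b : csummable a -> csummable b ->
  csum (fun y => a y - b y) = csum a - csum b.
Proof.
move=> sa sb; rewrite -mulN1r -csumZ// -csumD//; last exact: csummableZ.
by congr csum; apply/funext => y; rewrite mulN1r.
Qed.

(** Both [b + a] and [b - a] are nonnegative, so linearity gives the two inequalities. *)
Lemma csum_norm_le a b : csummable b -> (forall y, `|a y| <= b y) ->
  `|csum a| <= csum b.
Proof.
move=> sb ab; have sa := csummable_le sb ab.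
have Hp : 0 <= csum (fun y => b y + a y).
  apply: csum_ge0; last exact: csummableD.
  by move=> y; have := ab y; rewrite ler_norml => /andP[]; lra.
have Hm : 0 <= csum (fun y => b y - a y).
  apply: csum_ge0; last exact: csummableB.
  by move=> y; have := ab y; rewrite ler_norml => /andP[]; lra.
move: Hp Hm; rewrite csumD// csumB// ler_norml => *; apply/andP; split; lra.
Qed.

End CountableSums.

(** * Quadratic bound and second-order Taylor estimate for [Upsilon] near 0 *)

Section UpsilonBounds.
Context {R : realType}.
Implicit Types r : R.

Lemma Upsilon_ge0 r : 0 <= Upsilon r.
Proof. by have := expR_ge1Dx r; rewrite /Upsilon; lra. Qed.

(** The bound $e^{-r}\ge 1-r$ gives $(1-r)e^r\le 1$, while $(1-r)(1+r+2r^2)=1+r^2(1-2r)\ge 1$ for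
    $r\le 1/2$. *)
Lemma Upsilon_le r : `|r| <= 2^-1 -> Upsilon r <= 2 * r ^+ 2.
Proof.
rewrite ler_norml => /andP[r1 r2].
have e0 : 0 < expR r := expR_gt0 r.
have : (1 - r) * expR r <= 1.
  rewrite -[leRHS](expRxMexpNx_1 r) mulrC ler_pM2l//.
  exact: expR_ge1Dx.
rewrite /Upsilon expr2 => h.
suff : (1 - r) * (expR r) <= (1 - r) * (1 + r + 2 * (r * r)).
  by rewrite ler_pM2l; lra.
apply: (le_trans h); have := sqr_ge0 r; rewrite expr2; nra.
Qed.

Lemma is_derive_Upsilon r : is_derive r 1 Upsilon (expR r - 1).
Proof.
rewrite /Upsilon.
have : is_derive r 1 ((expR - cst 1) - id : R -> R) (expR r - 0 - 1).
  exact: is_deriveB.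
by rewrite subr0.
Qed.

Lemma derive1_Upsilon r : derive1 Upsilon r = expR r - 1.
Proof. by rewrite derive1E; have := is_derive_Upsilon r => -[]. Qed.

(** The remainder vanishes at 0 and its derivative is [Upsilon] itself, so the mean value theorem
    turns the quadratic bound on [Upsilon] into a cubic one. *)
Lemma Upsilon_taylor r : `|r| <= 2^-1 ->
  `|Upsilon r - r ^+ 2 / 2| <= 2 * `|r| ^+ 3.
Proof.
move=> hr.
pose g := (Upsilon - 2^-1 *: (id ^+ 2)) : R -> R.
have dg (t : R) : is_derive t 1 g (Upsilon t).
  have -> : Upsilon t = (expR t - 1) - t by [].
  apply: is_deriveB; first exact: is_derive_Upsilon.
  apply: is_derive_eq.
  by rewrite expr1 /GRing.scale/= mulr1 mulrA mulVf ?mul1r.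
have gE s : g s = Upsilon s - s ^+ 2 / 2.
  by rewrite /g !fctE /GRing.scale/= mulrC.
have g0 : g 0 = 0 by rewrite gE /Upsilon expR0; lra.
have cg (i : interval R) : {within [set` i], continuous g}.
  by apply: derivable_within_continuous => s _; have [] := dg s.
have [c [cr gr]] : exists c, `|c| <= `|r| /\ g r = Upsilon c * r.
  have [r0|r0] := leP 0 r.
    have [c] := MVT_segment r0 (fun t _ => dg t) (cg _).
    rewrite in_itv/= g0 !subr0 => /andP[c0 cr] ->; exists c.
    by rewrite !ger0_norm// (le_trans c0).
  have [c] := MVT_segment (ltW r0) (fun t _ => dg t) (cg _).
  rewrite in_itv/= g0 !sub0r => /andP[c0 cr] h; exists c.
  by split; [rewrite !ler0_norm ?lerN2// ltW | lra].
rewrite -gE gr normrM (ger0_norm (Upsilon_ge0 _)).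
rewrite exprSr mulrA ler_wpM2r//.
apply: le_trans (Upsilon_le (le_trans cr hr)) _.
by rewrite ler_pM2l// -(real_normK (num_real c)) lerXn2r.
Qed.

End UpsilonBounds.

(** * Weighted bounds for the generator and the carré du champ *)

Section SmallScaleExpansion.
Context {R : realType} {X : countType}.
Variables (k : X -> X -> R) (p : X -> R).
Hypothesis hk : markov_assumptions k p.
Implicit Types (f g h : X -> R) (x y z : X) (C M e : R).

Local Notation L := (generator k).

(* For bounded [f], [L f] and [Gamma f f] grow at most like the exit rate
   [- k y y]; the summand 1 makes the weight dominate bounded functions too,
   since the exit rates may approach 0. *)
Definition weight y : R := 1 - k y y.

(** Dominates, up to a constant, the terms of [L h x] whenever [h] grows at most like [weight]. *)
Definition edge_weight x y : R := `|k x y| * (weight x + weight y).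

Lemma weight_ge1 y : 1 <= weight y.
Proof. by have := rate_diag_lt0 hk y; rewrite /weight; lra. Qed.

Lemma edge_weight_ge0 x y : 0 <= edge_weight x y.
Proof.
by rewrite mulr_ge0// addr_ge0// (le_trans ler01)// weight_ge1.
Qed.

Lemma exit_rateE x : exit_rate k x = (- k x x)%:E.
Proof. by rewrite EFinN (rate_diag hk) oppeK. Qed.

(** The assumptions on the rates concern sums off the diagonal, whereas [csum] runs over all of
    [X]. *)
Lemma esum_punctured x (a : X -> R) :
  \esum_(y in [set: X]) `|(a y)%:E|%E =
  (`|(a x)%:E| + \esum_(y in [set~ x]) `|(a y)%:E|)%E.
Proof.
rewrite (esumID [set x])// setTI esum_set1//.
by rewrite setTI.
Qed.

(** The diagonal term and the exit rate contribute [- k x x] each. *)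
Lemma esum_rate x : \esum_(y in [set: X]) `|(k x y)%:E|%E = (- 2 * k x x)%:E.
Proof.
rewrite (esum_punctured x) (_ : esum _ _ = exit_rate k x); last first.
  apply: eq_esum => y /eqP yx /=.
  by rewrite ger0_norm// (rate_ge0 hk)// eq_sym.
rewrite exit_rateE -EFinD ltr0_norm ?(rate_diag_lt0 hk)//.
by congr (_%:E); lra.
Qed.

Lemma csummable_rate x : csummable (k x).
Proof. by rewrite /csummable /summable esum_rate ltry. Qed.

Lemma csum_rate x : csum (fun y => `|k x y|) = - 2 * k x x.
Proof.
rewrite ge0_csumE//; last exact/csummable_norm/csummable_rate.
by rewrite esum_rate.
Qed.

(** Off the diagonal the absolute values are the terms of the double sum in [exit_rate2_fin]. *)
Lemma csummable_rate2 x : csummable (fun y => k x y * k y y).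
Proof.
rewrite /csummable /summable (esum_punctured x (fun y => k x y * k y y)).
rewrite lte_add_pinfty ?ltry//.
apply: le_lt_trans (exit_rate2_fin hk x); apply: le_esum => y /eqP yx.
rewrite exit_rateE -EFinM lee_fin normrM (ltr0_norm (rate_diag_lt0 hk y)).
by rewrite ger0_norm// (rate_ge0 hk)// eq_sym.
Qed.

Lemma csummable_edge_weight x : csummable (edge_weight x).
Proof.
have s1 := csummableZ (weight x + 1) (csummable_norm (csummable_rate x)).
have s2 := csummable_norm (csummable_rate2 x).
apply: (csummable_le (csummableD s1 s2)) => y.
rewrite ger0_norm ?edge_weight_ge0// /edge_weight /weight normrM.
by rewrite (ltr0_norm (rate_diag_lt0 hk y)); lra.
Qed.

(** A constant depending only on the rates and [x]; it measures every error to which the outer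
    generator has been applied. *)
Definition vertex_weight x : R := csum (edge_weight x).

Lemma edge_csum x (a : X -> R) C : (forall y, `|a y| <= C * edge_weight x y) ->
  csummable a /\ `|csum a| <= C * vertex_weight x.
Proof.
move=> aC; have s := csummableZ C (csummable_edge_weight x).
split; first exact: csummable_le s aC.
by rewrite /vertex_weight -csumZ ?csum_norm_le//; exact: csummable_edge_weight.
Qed.

Lemma rate_csum x (a : X -> R) C : (forall y, `|a y| <= C * `|k x y|) ->
  csummable a /\ `|csum a| <= 2 * C * weight x.
Proof.
move=> aC; have s0 := csummable_norm (csummable_rate x).
have s := csummableZ C s0.
split; first exact: csummable_le s aC.
have : `|csum a| <= C * csum (fun y => `|k x y|).
  by rewrite -csumZ// csum_norm_le.
(* The sign of [C] is read off at [y = x], because [k x x] is nonzero. *)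
have C0 : 0 <= C.
  have := le_trans (normr_ge0 _) (aC x).
  by rewrite pmulr_lge0// normr_gt0 lt_eqF// (rate_diag_lt0 hk).
rewrite csum_rate /weight; lra.
Qed.

Lemma weighted_diff h C x y : (forall z, `|h z| <= C * weight z) ->
  `|k x y * (h y - h x)| <= C * edge_weight x y.
Proof.
move=> hC; rewrite normrM /edge_weight mulrCA ler_wpM2l//.
have := hC x; have := hC y; rewrite !ler_norml => /andP[? ?] /andP[? ?].
by apply/andP; split; lra.
Qed.

Lemma weighted_prod_diff f g M C x y : 0 <= M -> (forall z, `|f z| <= M) ->
  (forall z, `|g z| <= C * weight z) ->
  `|k x y * ((f y - f x) * (g y - g x))| <= 2 * M * C * edge_weight x y.
Proof.
move=> M0 fM gC; rewrite mulrCA normrM -mulrA ler_pM//; last exact: weighted_diff.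
have := fM x; have := fM y; rewrite !ler_norml => /andP[? ?] /andP[? ?].
by apply/andP; split; lra.
Qed.

Lemma generator_bound h C x : (forall z, `|h z| <= C * weight z) ->
  csummable (fun y => k x y * (h y - h x)) /\ `|L h x| <= C * vertex_weight x.
Proof. by move=> hC; apply: edge_csum => y; exact: weighted_diff. Qed.

Lemma generatorZ e h C x : (forall z, `|h z| <= C * weight z) ->
  L (fun z => e * h z) x = e * L h x.
Proof.
move=> /(generator_bound x)[s _]; rewrite /generator -csumZ//.
by congr csum; apply/funext => y; lra.
Qed.

Lemma generatorB h g C C' x : (forall z, `|h z| <= C * weight z) ->
  (forall z, `|g z| <= C' * weight z) ->
  L (fun z => h z - g z) x = L h x - L g x.
Proof.
move=> /(generator_bound x)[s _] /(generator_bound x)[s' _].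
rewrite /generator -csumB//.
by congr csum; apply/funext => y; lra.
Qed.

Lemma bounded_weight f M y : (forall z, `|f z| <= M) -> `|f y| <= M * weight y.
Proof.
move=> fM; apply: le_trans (fM y) _.
by rewrite ler_peMr ?weight_ge1// (le_trans _ (fM y)).
Qed.

Lemma generator_weight f M y : (forall z, `|f z| <= M) ->
  `|L f y| <= 4 * M * weight y.
Proof.
move=> fM; have -> : 4 * M = 2 * (2 * M) by lra.
apply: (proj2 (rate_csum _)) => z.
rewrite normrM mulrC ler_wpM2r//.
have := fM z; have := fM y; rewrite !ler_norml => /andP[? ?] /andP[? ?].
by apply/andP; split; lra.
Qed.

(** Discrete product rule: the increment of [f g] is the product of the increments plus [f x] and
    [g x] times the increments of [g] and [f]. Only weighted growth is asked of [g], so that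
    [g = L f] is allowed. *)
Lemma GammaE f g M C x : (forall z, `|f z| <= M) ->
  (forall z, `|g z| <= C * weight z) ->
  Gamma k f g x = 2^-1 * csum (fun y => k x y * ((f y - f x) * (g y - g x))).
Proof.
move=> fM gC; have M0 : 0 <= M := le_trans (normr_ge0 _) (fM x).
have sf := proj1 (generator_bound x (fun z => bounded_weight z fM)).
have sg := proj1 (generator_bound x gC).
have sfg : csummable (fun y => k x y * ((f y - f x) * (g y - g x))).
  by apply: (proj1 (edge_csum (C := 2 * M * C) _)) => y; exact: weighted_prod_diff.
rewrite /Gamma; congr (_ * _); rewrite /generator.
pose u y := k x y * (f y - f x); pose v y := k x y * (g y - g x).
pose w y := k x y * ((f y - f x) * (g y - g x)).
have -> : csum (fun y => k x y * ((f \* g) y - (f \* g) x)) =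
    csum w + f x * csum v + g x * csum u.
  have sv := csummableZ (f x) sg; have su := csummableZ (g x) sf.
  rewrite -(csumZ (f x) sg) -(csumZ (g x) sf) -(csumD sfg sv).
  rewrite -(csumD (csummableD sfg sv) su).
  by congr csum; apply/funext => y; rewrite /w /v /u /=; ring.
by rewrite /u /v /w; lra.
Qed.

(** * Expansions of both sides of the curvature inequality at [e f], for bounded [f] *)

Section Bounded.
Variables (f : X -> R) (M : R).
Hypothesis fM : forall z, `|f z| <= M.

Lemma diff_le y z : `|f z - f y| <= 2 * M.
Proof.
have := fM z; have := fM y; rewrite !ler_norml => /andP[? ?] /andP[? ?].
by apply/andP; split; lra.
Qed.

Lemma bound_ge0 x : 0 <= M. Proof. exact: le_trans (normr_ge0 _) (fM x). Qed.

Lemma sqr_diff_csum y : csummable (fun z => k y z * ((f z - f y) * (f z - f y))) /\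
  `|csum (fun z => k y z * ((f z - f y) * (f z - f y)))| <=
    2 * (4 * M ^+ 2) * weight y.
Proof.
apply: rate_csum => z; rewrite normrM mulrC ler_wpM2r// normrM.
rewrite (_ : 4 * M ^+ 2 = (2 * M) * (2 * M)); last by rewrite expr2; lra.
by rewrite ler_pM// diff_le.
Qed.

Lemma Gamma_weight y : `|Gamma k f f y| <= 4 * M ^+ 2 * weight y.
Proof.
rewrite (GammaE y fM (fun z => bounded_weight z fM)) normrM.
rewrite ger0_norm//; have := (sqr_diff_csum y).2; lra.
Qed.

Lemma scaled_diff_le e y z : 0 < e -> `|e * (f z - f y)| <= 2 * M * e.
Proof. by move=> e0; rewrite normrM gtr0_norm// mulrC ler_pM2r// diff_le. Qed.

(** Termwise Taylor estimate at [r = e * (f z - f y)]. The error is uniform in [y] relative to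
    [weight y], so the generator can be applied to it. *)
Lemma Psi_Upsilon_expansion e y : 0 < e -> 2 * M * e <= 2^-1 ->
  `|Psi_Upsilon k (fun z => e * f z) y - e ^+ 2 * Gamma k f f y|
    <= 32 * M ^+ 3 * e ^+ 3 * weight y.
Proof.
move=> e0 eM; have dle z := scaled_diff_le y z e0.
have dM z := le_trans (dle z) eM.
(* Only summability is kept; the crude bound [Upsilon r <= 1] suffices. *)
have [s1 _] : csummable (fun z => k y z * Upsilon (e * f z - e * f y)) /\
    `|csum (fun z => k y z * Upsilon (e * f z - e * f y))| <= 2 * 1 * weight y.
  apply: rate_csum => z; rewrite -mulrBr normrM mulrC ler_wpM2r//.
  rewrite ger0_norm ?Upsilon_ge0//; apply: le_trans (Upsilon_le (dM z)) _.
  have := dM z; rewrite ler_norml expr2 => /andP[]; nra.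
have [s2 _] := sqr_diff_csum y.
rewrite (GammaE y fM (fun z => bounded_weight z fM)) mulrA -csumZ//.
rewrite -csumB//; last exact: csummableZ.
(* The outer 2 comes from [rate_csum], the inner one from [Upsilon_taylor]. *)
rewrite (_ : 32 * M ^+ 3 * e ^+ 3 = 2 * (2 * (2 * M * e) ^+ 3)); last first.
  by rewrite !exprMn; lra.
apply: (proj2 (rate_csum _)) => z.
rewrite -mulrBr (_ : _ - _ * (_ * (_ * _)) =
  (Upsilon (e * (f z - f y)) - (e * (f z - f y)) ^+ 2 / 2) * k y z); last by ring.
rewrite normrM ler_wpM2r//; apply: le_trans (Upsilon_taylor (dM z)) _.
by rewrite ler_pM2l// lerXn2r// nnegrE (le_trans _ (dle z)).
Qed.

(** Since $\Upsilon'(r)=r+\Upsilon(r)$ exactly, the linear part gives the term in [Gamma k f (L f)]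
    and the quadratic bound on [Upsilon] controls the rest. *)
Lemma B_Upsilon_expansion e x : 0 < e -> 2 * M * e <= 2^-1 ->
  `|B_Upsilon' k (fun z => e * f z) (L (fun z => e * f z)) x
     - 2 * e ^+ 2 * Gamma k f (L f) x|
    <= 32 * M ^+ 3 * e ^+ 3 * vertex_weight x.
Proof.
move=> e0 eM; have dle z := scaled_diff_le x z e0.
have dM z := le_trans (dle z) eM; have M0 := bound_ge0 x.
have Lw y := generator_weight y fM.
rewrite (_ : L (fun z => e * f z) = fun z => e * L f z); last first.
  by apply/funext => y; rewrite (generatorZ _ _ (fun z => bounded_weight z fM)).
have [s2 _] : csummable (fun y => k x y * ((f y - f x) * (L f y - L f x))) /\
    `|csum (fun y => k x y * ((f y - f x) * (L f y - L f x)))|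
      <= 2 * M * (4 * M) * vertex_weight x.
  by apply: edge_csum => y; exact: weighted_prod_diff.
have [s3 b3] : csummable (fun y => k x y * (L f y - L f x)
      * (e * Upsilon (e * (f y - f x)))) /\
    `|csum (fun y => k x y * (L f y - L f x) * (e * Upsilon (e * (f y - f x))))|
      <= 32 * M ^+ 3 * e ^+ 3 * vertex_weight x.
  apply: edge_csum => y; rewrite normrM.
  (* Here [4 * M] bounds [L f] relative to [weight], [e] comes from [L (e f) = e L f], and the last
     factor is [Upsilon_le]. *)
  rewrite (_ : 32 * M ^+ 3 * e ^+ 3 * _ =
    (4 * M * edge_weight x y) * (e * (2 * (2 * M * e) ^+ 2))); last first.
    by rewrite !exprMn !exprS; lra.
  rewrite ler_pM// ?weighted_diff// normrM gtr0_norm// ler_pM2l//.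
  rewrite ger0_norm ?Upsilon_ge0//; apply: le_trans (Upsilon_le (dM y)) _.
  rewrite ler_pM2l// -(real_normK (num_real (_ * _))).
  by rewrite lerXn2r// nnegrE (le_trans _ (dle y)).
rewrite (GammaE x fM Lw) /B_Upsilon'.
rewrite (_ : csum _ = csum (fun y => k x y * (L f y - L f x)
    * (e * Upsilon (e * (f y - f x)))) +
  e ^+ 2 * csum (fun y => k x y * ((f y - f x) * (L f y - L f x)))).
  by rewrite (_ : _ + _ - _ = csum (fun y => k x y * (L f y - L f x)
    * (e * Upsilon (e * (f y - f x))))) //; lra.
rewrite -csumZ// -csumD//; last exact: csummableZ.
congr csum; apply/funext => y; rewrite derive1_Upsilon -!mulrBr /Upsilon.
by rewrite expr2; lra.
Qed.

(** Both terms of [Psi2_Upsilon] carry the same error bound, and the prefactor 1/2 averages them. *)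
Lemma Psi2_Upsilon_expansion e x : 0 < e -> 2 * M * e <= 2^-1 ->
  `|Psi2_Upsilon k (fun z => e * f z) x - e ^+ 2 * Gamma2 k f x|
    <= 32 * M ^+ 3 * e ^+ 3 * vertex_weight x.
Proof.
move=> e0 eM; have B := B_Upsilon_expansion x e0 eM.
have E y := Psi_Upsilon_expansion y e0 eM.
have [_ LE] := generator_bound x E.
have GL z : `|e ^+ 2 * Gamma k f f z| <= e ^+ 2 * (4 * M ^+ 2) * weight z.
  by rewrite normrM ger0_norm ?sqr_ge0// -mulrA ler_wpM2l ?sqr_ge0 ?Gamma_weight.
(* Weighted growth of [Psi_Upsilon] lets [L] be split over the difference in [E]. *)
have PW z : `|Psi_Upsilon k (fun z => e * f z) z| <=
    (32 * M ^+ 3 * e ^+ 3 + e ^+ 2 * (4 * M ^+ 2)) * weight z.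
  rewrite -[X in `|X|](subrK (e ^+ 2 * Gamma k f f z)) mulrDl.
  by rewrite (le_trans (ler_normD _ _))// lerD.
move: LE B; rewrite (generatorB x PW GL) (generatorZ _ _ Gamma_weight).
rewrite /Psi2_Upsilon /Gamma2 !ler_norml => /andP[? ?] /andP[? ?].
by apply/andP; split; lra.
Qed.

End Bounded.
End SmallScaleExpansion.

(** * Passage to the limit of small scale *)

Theorem proposition2p11 (R : realType) (X : countType) (k : X -> X -> R)
    (p : X -> R) (hk : markov_assumptions k p) (kappa : R)
    (hCD : CD_Upsilon k kappa) : CD k kappa.
Proof.
move=> f fb x; have PF := globally_properfilter (I : [set: X] x).
have [M fT] := (@ex_bound _ _ _ _ _ PF).1 fb.
have fM z : `|f z| <= M by exact: fT.
have M0 : 0 <= M := bound_ge0 fM x.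
set W := weight k x; set V := vertex_weight k x.
(* [K * e ^+ 3] bounds the total error: [kappa] times that of [Psi_Upsilon], plus that of
   [Psi2_Upsilon]. *)
set K := 32 * M ^+ 3 * (`|kappa| * `|W| + `|V|).
have K0 : 0 <= K by rewrite mulr_ge0 ?addr_ge0 ?mulr_ge0 ?exprn_ge0.
apply/ler_addgt0Pr => d d0.
(* The first entry keeps increments of [e f] within 1/2, the second makes the error at most [d]
   after division by [e ^+ 2]; adding 1 keeps the denominators positive. *)
pose e := Num.min (4 * M + 1)^-1 (d / (K + 1)).
have e0 : 0 < e by rewrite lt_min invr_gt0 divr_gt0//; lra.
have eM : 2 * M * e <= 2^-1.
  have : e <= (4 * M + 1)^-1 by rewrite ge_min lexx.
  rewrite -div1r ler_pdivlMr; lra.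
have eK : K * e <= d.
  have : e <= d / (K + 1) by rewrite ge_min lexx orbT.
  rewrite ler_pdivlMr; lra.
have fe : bounded_fun (fun z => e * f z).
  apply/(@ex_bound _ _ _ _ _ PF); exists (e * M) => z _ /=.
  by rewrite normrM gtr0_norm// ler_pM2l.
have := hCD _ fe x.
have := Psi2_Upsilon_expansion hk fM x e0 eM.
have := Psi_Upsilon_expansion hk fM x e0 eM.
rewrite -/W -/V.
set P := Psi_Upsilon _ _ _; set P2 := Psi2_Upsilon _ _ _.
move=> hP /ler_normlP[_ hP2] hcd.
(* Scaled by [e ^+ 2], the goal is the inequality for [e f] up to the two expansion errors. *)
rewrite -(ler_pM2l (exprn_gt0 2 e0)).
have hk1 : - (kappa * (P - e ^+ 2 * Gamma k f f x)) <=
    `|kappa| * (32 * M ^+ 3 * e ^+ 3 * `|W|).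
  rewrite -mulNr (le_trans (ler_norm _))// normrM normrN ler_wpM2l//.
  apply: (le_trans hP); rewrite ler_wpM2l ?ler_norm//.
  by rewrite !mulr_ge0 ?exprn_ge0// ltW.
have hk2 : 32 * M ^+ 3 * e ^+ 3 * V <= 32 * M ^+ 3 * e ^+ 3 * `|V|.
  by rewrite ler_wpM2l ?ler_norm// !mulr_ge0 ?exprn_ge0// ltW.
have hk3 : e ^+ 2 * (K * e) <= e ^+ 2 * d by rewrite ler_pM2l// exprn_gt0.
have hk4 : e ^+ 2 * (K * e) = `|kappa| * (32 * M ^+ 3 * e ^+ 3 * `|W|)
  + 32 * M ^+ 3 * e ^+ 3 * `|V| by rewrite /K; ring.
lra.
Qed.
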